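(* Let $H$ and $K$ be finite index subgroups of the group $G=\langle X\mid R\rangle$, where $X$ is finite and $R$ is not necessarily finite. Let $\Gamma(H)\times_1\Gamma(K)$ be the connected component of the product graph $\Gamma(H)\times\Gamma(K)$ containing $1_H\times 1_K$. Then $(\Gamma(H)\times_1\Gamma(K),\,1_H\times 1_K)$ is the subgroup graph (up to isomorphism of based $X$-graphs) of the subgroup $H\cap K$ of $G$.
   Context: An $X$-graph is a directed graph (loops and multiple edges allowed) in which every directed edge carries a label from $X$. Isomorphisms of based $X$-graphs preserve vertices, directed edges, labels, origins, termini and the base-vertex. For a finite index subgroup $H$ of $G=\langle X\mid R\rangle$, the subgroup graph $\Gamma(H)=\Gamma_{X,R}(H)$ is the Schreier coset graph of $H$ with respect to $X$ and $G$: its vertices are the right cosets $Hg$ ($g\in G$), and for each coset $Hg$ and each $x\in X$ there is one directed edge labeled $x$ with origin $Hg$ and terminus $Hgx$. Its base-vertex $1_H$ is the coset $H$. The product graph $\Gamma\times\Gamma'$ of two $X$-graphs has vertex set $V(\Gamma)\times V(\Gamma')$, a vertex $(u,v)$ being written $u\times v$; for vertices $u\times v$, $u'\times v'$ and $x\in X$ there is an edge labeled $x$ from $u\times v$ to $u'\times v'$ whenever there is an edge labeled $x$ from $u$ to $u'$ in $\Gamma$ and an edge labeled $x$ from $v$ to $v'$ in $\Gamma'$. Connectedness refers to the underlying undirected graph. *)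

(* Defs.v *)
From HB Require Import structures.
From Stdlib Require Import Relation_Operators.
From mathcomp Require Import all_boot.
From mathcomp Require Import boolp classical_sets functions cardinality.

Set Implicit Arguments.
Unset Strict Implicit.
Unset Printing Implicit Defensive.

Local Open Scope classical_set_scope.
Local Open Scope group_scope.
Local Open Scope quotient_scope.

(* A letter (x, b) stands for x if b = false and for the inverse of x if
   b = true. *)
Definition letter (X : choiceType) : choiceType := (X * bool)%type.
Definition word (X : choiceType) : choiceType := seq (letter X).

Definition flip (X : choiceType) (l : letter X) : letter X := (l.1, ~~ l.2).
Definition invw (X : choiceType) (w : word X) : word X := rev (map (@flip X) w).

(* The least congruence on words that makes every letter inverse to its flip
   and every relator trivial. *)
Inductive pres_eq (X : choiceType) (R : set (word X)) : word X -> word X -> Prop :=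
| pres_refl u : pres_eq R u u
| pres_sym u v : pres_eq R u v -> pres_eq R v u
| pres_trans u v w : pres_eq R u v -> pres_eq R v w -> pres_eq R u w
| pres_cat u u' v v' :
    pres_eq R u u' -> pres_eq R v v' -> pres_eq R (u ++ v) (u' ++ v')
| pres_cancel l : pres_eq R [:: l; flip l] [::]
| pres_rel r : R r -> pres_eq R r [::].

Section PresentedGroup.
Variables (X : choiceType) (R : set (word X)).

Definition pres_eqb : rel (word X) := fun u v => `[< pres_eq R u v >].

Lemma pres_eqb_refl : reflexive pres_eqb.
Proof. by move=> u; apply/asboolP; apply: pres_refl. Qed.

Lemma pres_eqb_sym : symmetric pres_eqb.
Proof. by move=> u v; apply/asboolP/asboolP; apply: pres_sym. Qed.

Lemma pres_eqb_trans : transitive pres_eqb.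
Proof.
by move=> v u w /asboolP uv /asboolP vw; apply/asboolP; apply: pres_trans vw.
Qed.

Canonical pres_equiv := EquivRel pres_eqb pres_eqb_refl pres_eqb_sym pres_eqb_trans.

Definition pres_group := {eq_quot pres_equiv}.
HB.instance Definition _ := Choice.on pres_group.
HB.instance Definition _ := EqQuotient.on pres_group.

Definition pg_class (w : word X) : pres_group := \pi_pres_group w.
Definition pg_gen (x : X) : pres_group := pg_class [:: (x, false)].
Definition pg_one : pres_group := pg_class [::].
Definition pg_mul (a b : pres_group) : pres_group := pg_class (repr a ++ repr b).
Definition pg_inv (a : pres_group) : pres_group := pg_class (invw (repr a)).

Lemma pg_classP u v : pg_class u = pg_class v <-> pres_eq R u v.
Proof.
split; first by move/eqmodP => /asboolP.
by move=> h; apply/eqmodP; apply/asboolP.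
Qed.

Lemma pg_reprK a : pg_class (repr a) = a.
Proof. exact: reprK. Qed.

Lemma pres_repr u : pres_eq R (repr (pg_class u)) u.
Proof. by apply/pg_classP; rewrite pg_reprK. Qed.

Lemma flipK : involutive (@flip X).
Proof. by case=> x b; rewrite /flip /= negbK. Qed.

Lemma invwK : involutive (@invw X).
Proof.
by move=> w; rewrite /invw map_rev revK -map_comp map_id_in // => l _; apply: flipK.
Qed.

Lemma pres_mulV w : pres_eq R (w ++ invw w) [::].
Proof.
elim: w => [|l w IH]; first exact: pres_refl.
rewrite /invw /= rev_cons -cats1 -/(invw w).
apply: (pres_trans (v := [:: l; flip l])); last exact: pres_cancel.
rewrite -cat1s -[X in pres_eq _ _ X](cat1s l); apply: pres_cat; first exact: pres_refl.
by rewrite catA -[X in pres_eq _ _ X]cat0s; apply: pres_cat => //; apply: pres_refl.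
Qed.

Lemma pg_mulE u v : pg_mul (pg_class u) (pg_class v) = pg_class (u ++ v).
Proof. by apply/pg_classP; apply: pres_cat; apply: pres_repr. Qed.

Lemma pg_mulA : associative pg_mul.
Proof.
move=> a b c; rewrite -[a]pg_reprK -[b]pg_reprK -[c]pg_reprK.
by rewrite !pg_mulE catA.
Qed.

Lemma pg_mul1 : left_id pg_one pg_mul.
Proof. by move=> a; rewrite -[a]pg_reprK pg_mulE. Qed.

Lemma pg_1mul : right_id pg_one pg_mul.
Proof. by move=> a; rewrite -[a]pg_reprK pg_mulE cats0. Qed.

Lemma pg_mulV : right_inverse pg_one pg_inv pg_mul.
Proof.
move=> a; rewrite -[in X in pg_mul X _](pg_reprK a) pg_mulE.
by apply/pg_classP; apply: pres_mulV.
Qed.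

Lemma pg_Vmul : left_inverse pg_one pg_inv pg_mul.
Proof.
move=> a; rewrite -[in X in pg_mul _ X](pg_reprK a) pg_mulE.
by apply/pg_classP; rewrite -[X in _ ++ X]invwK; apply: pres_mulV.
Qed.

HB.instance Definition _ :=
  isGroup.Build pres_group pg_mulA pg_mul1 pg_1mul pg_Vmul pg_mulV.

End PresentedGroup.

Definition rtranslate (G : groupType) (A : set G) (g : G) : set G :=
  [set a * g | a in A].

Definition right_cosets (G : groupType) (H : set G) : set (set G) :=
  range (rtranslate H).

Definition finite_index_subgroup (G : groupType) (H : set G) : Prop :=
  group_closed (mem H) /\ finite_set (right_cosets H).

Record xgraph (X : Type) := XGraph {
  vertex : Type;
  edge : Type;
  origin : edge -> vertex;
  terminus : edge -> vertex;
  label : edge -> X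
}.

Record based_xgraph (X : Type) := BasedXGraph {
  graph_of :> xgraph X;
  base : vertex graph_of
}.

Definition based_isomorphic (X : Type) (A B : based_xgraph X) : Prop :=
  exists (f : vertex A -> vertex B) (h : edge A -> edge B),
    [/\ bijective f, bijective h,
        forall e, origin (h e) = f (origin e) /\ terminus (h e) = f (terminus e),
        forall e, label (h e) = label e
      & f (base A) = base B].

Definition has_edge (X : Type) (A : xgraph X) (u : vertex A) (x : X)
    (u' : vertex A) : Prop :=
  exists e : edge A, [/\ origin e = u, label e = x & terminus e = u'].

(* One edge per triple (u * v, x, u' * v'), even when A or B has parallel
   edges with the same label. *)
Definition product_edge (X : Type) (A B : xgraph X) : Type :=
  {t : (vertex A * vertex B) * X * (vertex A * vertex B) |
    has_edge t.1.1.1 t.1.2 t.2.1 /\ has_edge t.1.1.2 t.1.2 t.2.2}.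

Definition product_graph (X : Type) (A B : xgraph X) : xgraph X :=
  {| vertex := vertex A * vertex B;
     edge := product_edge A B;
     origin := fun e => (sval e).1.1;
     terminus := fun e => (sval e).2;
     label := fun e => (sval e).1.2 |}.

Definition adjacent (X : Type) (A : xgraph X) (u v : vertex A) : Prop :=
  exists e : edge A, origin e = u /\ terminus e = v.

Definition connected_to (X : Type) (A : xgraph X) : vertex A -> vertex A -> Prop :=
  clos_refl_sym_trans (vertex A) (@adjacent X A).

Definition induced_subgraph (X : Type) (A : xgraph X) (P : vertex A -> Prop) :
    xgraph X :=
  {| vertex := {v : vertex A | P v};
     edge := {e : edge A | P (origin e) /\ P (terminus e)};
     origin := fun e => exist _ (origin (sval e)) (proj1 (svalP e));
     terminus := fun e => exist _ (terminus (sval e)) (proj2 (svalP e));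
     label := fun e => label (sval e) |}.

Definition component (X : Type) (A : xgraph X) (v : vertex A) : based_xgraph X :=
  {| graph_of := induced_subgraph (connected_to v);
     base := exist _ v (rst_refl _ _ v) |}.

Definition component_product (X : Type) (A B : based_xgraph X) : based_xgraph X :=
  @component X (product_graph A B) (base A, base B).

Section SubgroupGraph.
Variables (X : choiceType) (R : set (word X)) (H : set (pres_group R)).

Definition coset_vertex : Type := {A : set (pres_group R) | right_cosets H A}.

Lemma right_coset_base : right_cosets H H.
Proof.
exists 1 => //; apply/seteqP; split => [_ [h Hh <-]|h Hh]; first by rewrite mulg1.
by exists h; rewrite ?mulg1.
Qed.

Lemma right_coset_translate (A : set (pres_group R)) g :
  right_cosets H A -> right_cosets H (rtranslate A g).
Proof.
move=> [k _ <-]; exists (k * g) => //; apply/seteqP; split => [_ [h Hh <-]|].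
  by exists (h * k); [exists h | rewrite mulgA].
by move=> _ [_ [h Hh <-] <-]; exists h; rewrite ?mulgA.
Qed.

(* The edge (H g, x) runs from H g to H g x. *)
Definition subgroup_graph : based_xgraph X :=
  {| graph_of :=
       {| vertex := coset_vertex;
          edge := coset_vertex * X;
          origin := fun e => e.1;
          terminus := fun e =>
            exist _ (rtranslate (sval e.1) (pg_gen R e.2))
                    (right_coset_translate (pg_gen R e.2) (svalP e.1));
          label := fun e => e.2 |};
     base := exist _ H right_coset_base |}.

End SubgroupGraph.

(* Main.v *)
Require Import Defs.
From Stdlib Require Import Relation_Operators.
From mathcomp Require Import all_boot.
From mathcomp Require Import boolp classical_sets functions cardinality.

Set Implicit Arguments.
Unset Strict Implicit.
Unset Printing Implicit Defensive.

Local Open Scope classical_set_scope.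

(** A coset of [H `&` K] is the intersection of a coset of [H] and a coset of
    [K]: [(H `&` K) g = H g `&` K g].  Sending the vertex [(A, B)] of the product
    graph to [A `&` B] is the isomorphism.

    It is meaningful because the component of [(H, K)] consists exactly of the
    pairs [(H g, K g)] with a common [g]: following an edge labeled [x], forwards
    or backwards, multiplies both cosets by the same element, and conversely a
    word representing [g] spells a walk from [(H, K)] to [(H g, K g)]
    ([connected_base]).  On such pairs the map is onto the cosets of [H `&` K], and
    it is injective since two cosets of a subgroup that share an element are
    equal, while [H g `&` K g] contains [g] ([coset_pair_inj]).  An edge of a
    coset graph is determined by its origin and its label, in the component of
    the product just as in the graph of [H `&` K], so the bijection on vertices
    induces one on edges.

    The formula for cosets also shows that [H `&` K] has finite index, as its
    cosets are intersections of members of two finite families. *)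

(** * Cosets of an intersection *)

Section Cosets.
Variable G : groupType.
Implicit Types (A H K : set G) (g k : G).
Local Open Scope group_scope.

Lemma rtranslateE A g : rtranslate A g = [set y | A (y * g^-1)].
Proof.
apply/seteqP; split => [_ [a Aa <-]|y Ay] /=; first by rewrite mulgK.
by exists (y * g^-1); rewrite ?mulgVK.
Qed.

Lemma rtranslate1 A : rtranslate A 1 = A.
Proof. by rewrite rtranslateE; apply/seteqP; split=> y /=; rewrite invg1 mulg1. Qed.

Lemma rtranslateM A g k : rtranslate (rtranslate A g) k = rtranslate A (g * k).
Proof.
by rewrite !rtranslateE; apply/seteqP; split=> y /=; rewrite invgM mulgA.
Qed.

Lemma rtranslateI H K g :
  rtranslate (H `&` K) g = rtranslate H g `&` rtranslate K g.
Proof. by rewrite !rtranslateE. Qed.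

Lemma group_closedI H K :
  group_closed (mem H) -> group_closed (mem K) ->
  group_closed (mem (H `&` K)).
Proof.
move=> [H1 HV] [K1 KV]; split; first by rewrite in_setI H1.
move=> x y; rewrite !in_setI => /andP[Hx Kx] /andP[Hy Ky].
by rewrite HV // KV.
Qed.

Lemma rtranslate_self H g : group_closed (mem H) -> rtranslate H g g.
Proof. by move=> [/set_mem H1 _]; rewrite rtranslateE /= mulgV. Qed.

Lemma rtranslate_eq H g k :
  group_closed (mem H) -> rtranslate H k g -> rtranslate H g = rtranslate H k.
Proof.
move=> Hgr [h Hh <-]; rewrite -rtranslateM; congr rtranslate.
rewrite rtranslateE; apply/seteqP; split => y /= Hy; apply/set_mem.
  rewrite -(mulgVK h y).
  by apply: (group_closedM Hgr); apply/mem_set.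
by case: Hgr => _; apply; apply/mem_set.
Qed.

(** Both intersections contain [g], and a coset of a subgroup is determined by any
    of its elements. *)
Lemma coset_pair_inj H K g k :
  group_closed (mem H) -> group_closed (mem K) ->
  rtranslate H g `&` rtranslate K g = rtranslate H k `&` rtranslate K k ->
  rtranslate H g = rtranslate H k /\ rtranslate K g = rtranslate K k.
Proof.
move=> Hgr Kgr eqHK.
have : (rtranslate H g `&` rtranslate K g) g.
  by split; apply: rtranslate_self.
by rewrite eqHK => -[Hg Kg]; split; apply: rtranslate_eq.
Qed.

Lemma finite_index_subgroupI H K :
  finite_index_subgroup H -> finite_index_subgroup K ->
  finite_index_subgroup (H `&` K).
Proof.
move=> [Hgr Hfin] [Kgr Kfin]; split; first exact: group_closedI.
rewrite /right_cosets
  (_ : rtranslate _ = fun g => rtranslate H g `&` rtranslate K g).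
  exact: finite_image11.
by apply/funext => g; apply: rtranslateI.
Qed.

End Cosets.

(** * The component of the base-vertex *)

Lemma sval_inj (T : Type) (P : T -> Prop) : injective (@sval T P).
Proof. by move=> [x px] [y py] /= eqxy; apply: eq_exist. Qed.

Section Component.
Variables (X : choiceType) (R : set (word X)).
Implicit Types (H K : set (pres_group R)) (g : pres_group R).
Local Open Scope group_scope.

Lemma pg_class_inv_letter (x : X) :
  pg_class R [:: (x, true)] = (pg_gen R x)^-1.
Proof.
rewrite -[LHS](mulKg (pg_gen R x)) [X in _ * X]pg_mulE.
suff -> : pg_class R [:: (x, false); (x, true)] = 1 by rewrite mulg1.
by apply/pg_classP; apply: (pres_cancel R (x, false)).
Qed.

(** Peel off the last letter of a word representing [g].  Inverse generators need
    a case of their own because edges carry only positive labels: such a letter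
    is a backward step in the graph. *)
Lemma pres_group_ind (P : pres_group R -> Prop) :
  P 1 ->
  (forall g x, P g -> P (g * pg_gen R x)) ->
  (forall g x, P g -> P (g * (pg_gen R x)^-1)) ->
  forall g, P g.
Proof.
move=> P1 Pgen Pinv g; rewrite -[g]pg_reprK.
elim/last_ind: (repr g) => [//|w [x b] Pw].
rewrite -cats1 -pg_mulE; case: b; last exact: Pgen.
by rewrite pg_class_inv_letter; apply: Pinv.
Qed.

Definition coset_at H g : coset_vertex H :=
  exist _ (rtranslate H g) (imageT (rtranslate H) g).

Lemma coset_atP H (A : coset_vertex H) g :
  A = coset_at H g <-> sval A = rtranslate H g.
Proof. by split=> [->//|eqA]; apply: sval_inj. Qed.

Lemma base_subgroup_graph H : base (subgroup_graph H) = coset_at H 1.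
Proof. by apply/coset_atP; rewrite rtranslate1. Qed.

Lemma has_edgeP H (A B : coset_vertex H) x :
  @has_edge X (subgroup_graph H) A x B <->
  sval B = rtranslate (sval A) (pg_gen R x).
Proof.
split=> [[[C y] /= [<- <- <-]] //|eqB].
by exists (A, x); split=> //; apply: sval_inj.
Qed.

Lemma adjacent_productP H K (p q : coset_vertex H * coset_vertex K) :
  @adjacent X (product_graph (subgroup_graph H) (subgroup_graph K)) p q <->
  exists x, sval q.1 = rtranslate (sval p.1) (pg_gen R x) /\
            sval q.2 = rtranslate (sval p.2) (pg_gen R x).
Proof.
split=> [[[[[u x] v] /= [/has_edgeP e1 /has_edgeP e2]] /= [<- <-]]|[x [e1 e2]]].
  by exists x.
have edge1 : @has_edge X (subgroup_graph H) p.1 x q.1 by apply/has_edgeP.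
have edge2 : @has_edge X (subgroup_graph K) p.2 x q.2 by apply/has_edgeP.
by exists (exist _ (p, x, q) (conj edge1 edge2)).
Qed.

(** Adjacent pairs [(A, B)] and [(A x, B x)] are both of the form [(H g, K g)] or
    neither is: hence such pairs are closed under undirected paths. *)
Lemma connected_base H K (p : coset_vertex H * coset_vertex K) :
  @connected_to X (product_graph (subgroup_graph H) (subgroup_graph K))
    (base (subgroup_graph H), base (subgroup_graph K)) p <->
  exists g, p = (coset_at H g, coset_at K g).
Proof.
rewrite !base_subgroup_graph; split=> [conn|[g ->]].
  pose diag (q : coset_vertex H * coset_vertex K) :=
    exists g, q = (coset_at H g, coset_at K g).
  suff [diag_iff _] : diag (coset_at H 1, coset_at K 1) <-> diag p.
    by apply: diag_iff; exists 1.
  elim: conn => {p} [[A B] [C D]|//|p q _ [? ?]|p q r _ [? ?] _ [? ?]].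
  - move=> /adjacent_productP [x /= [eC eD]].
    split=> -[g [/coset_atP eA /coset_atP eB]].
      exists (g * pg_gen R x); congr pair; apply/coset_atP.
        by rewrite eC eA rtranslateM.
      by rewrite eD eB rtranslateM.
    exists (g * (pg_gen R x)^-1); congr pair; apply/coset_atP.
      by rewrite -rtranslateM -eA eC rtranslateM mulgV rtranslate1.
    by rewrite -rtranslateM -eB eD rtranslateM mulgV rtranslate1.
  - by split.
  - by split; auto.
elim/pres_group_ind: g => [|g x IH|g x IH]; first exact: rst_refl.
  apply: rst_trans IH _; apply: rst_step; apply/adjacent_productP.
  by exists x; rewrite /= !rtranslateM.
apply: rst_trans IH _; apply: rst_sym; apply: rst_step; apply/adjacent_productP.
by exists x; rewrite /= !rtranslateM mulgVK.
Qed.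

End Component.

(** * The isomorphism *)

Section Isomorphism.
Variables (X : choiceType) (R : set (word X)) (H K : set (pres_group R)).
Hypotheses (Hgr : group_closed (mem H)) (Kgr : group_closed (mem K)).

Let GHK := component_product (subgroup_graph H) (subgroup_graph K).
Let GI := subgroup_graph (H `&` K).

Lemma component_vertexP (v : vertex GHK) :
  exists g, sval v = (coset_at H g, coset_at K g).
Proof. exact/connected_base/(svalP v). Qed.

Lemma right_coset_meet (v : vertex GHK) :
  right_cosets (H `&` K) (sval (sval v).1 `&` sval (sval v).2).
Proof.
by have [g ->] := component_vertexP v; exists g => //; apply: rtranslateI.
Qed.

Definition meet_vertex (v : vertex GHK) : vertex GI :=
  exist _ _ (right_coset_meet v).

Definition meet_edge (e : edge GHK) : edge GI :=
  (meet_vertex (origin e), label e).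

Lemma meet_vertex_inj : injective meet_vertex.
Proof.
move=> u v.
have [g eu] := component_vertexP u; have [k ev] := component_vertexP v.
move=> /(congr1 sval); rewrite /= eu ev /= => /(coset_pair_inj Hgr Kgr)[eH eK].
by apply: sval_inj; rewrite eu ev; congr pair; apply/coset_atP.
Qed.

Lemma meet_vertex_surj (A : vertex GI) : exists v, meet_vertex v = A.
Proof.
have [g _ eA] := svalP A.
have conn := (connected_base (coset_at H g, coset_at K g)).2
  (ex_intro _ g erefl).
exists (exist _ _ conn); apply: sval_inj => /=.
by rewrite -rtranslateI.
Qed.

Lemma meet_vertex_bij : bijective meet_vertex.
Proof.
rewrite -setTT_bijective; split=> //; first by move=> ? ? _ _; apply: meet_vertex_inj.
by move=> A _; have [v <-] := meet_vertex_surj A; exists v.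
Qed.

Lemma component_edge_terminus (e : edge GHK) :
  sval (sval (terminus e)).1 =
    rtranslate (sval (sval (origin e)).1) (pg_gen R (label e)) /\
  sval (sval (terminus e)).2 =
    rtranslate (sval (sval (origin e)).2) (pg_gen R (label e)).
Proof. by case: e => [[t [e1 e2]] ?]; split; apply/has_edgeP. Qed.

(** Coset graphs are deterministic, so the terminus is forced; and the product has
    a single edge for each origin, label and terminus. *)
Lemma component_edge_inj (e e' : edge GHK) :
  origin e = origin e' -> label e = label e' -> e = e'.
Proof.
move=> eo el.
have et : terminus e = terminus e'.
  have [e1 e2] := component_edge_terminus e.
  have [e1' e2'] := component_edge_terminus e'.
  apply: sval_inj; rewrite [LHS]surjective_pairing [RHS]surjective_pairing.
  by congr pair; apply: sval_inj; rewrite ?e1 ?e2 ?e1' ?e2' eo el.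
do 2!apply: sval_inj.
move: (congr1 sval eo) (congr1 sval et) el => /=.
by case: (sval (sval e)) (sval (sval e')) => -[u x] w [[u' x'] w'] /= -> -> ->.
Qed.

Lemma component_edge_ex (v : vertex GHK) (x : X) :
  exists e : edge GHK, origin e = v /\ label e = x.
Proof.
have [g ev] := component_vertexP v.
pose p := (coset_at H g, coset_at K g).
pose q := (coset_at H (g * pg_gen R x)%g, coset_at K (g * pg_gen R x)%g).
have edge1 : @has_edge X (subgroup_graph H) p.1 x q.1.
  by apply/has_edgeP; rewrite /= rtranslateM.
have edge2 : @has_edge X (subgroup_graph K) p.2 x q.2.
  by apply/has_edgeP; rewrite /= rtranslateM.
have connp := (connected_base p).2 (ex_intro _ g erefl).
have connq := (connected_base q).2 (ex_intro _ (g * pg_gen R x)%g erefl).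
pose t : edge (product_graph (subgroup_graph H) (subgroup_graph K)) :=
  exist _ (p, x, q) (conj edge1 edge2).
by exists (exist _ t (conj connp connq)); split=> //; apply: sval_inj.
Qed.

Lemma meet_edge_bij : bijective meet_edge.
Proof.
rewrite -setTT_bijective; split=> // [e e' _ _ [eo el]|[A x] _].
  by apply: component_edge_inj => //; apply: meet_vertex_inj; apply: sval_inj.
have [v <-] := meet_vertex_surj A.
by have [e [eo el]] := component_edge_ex v x; exists e; rewrite // /meet_edge eo el.
Qed.

Lemma meet_vertex_terminus (e : edge GHK) :
  terminus (meet_edge e) = meet_vertex (terminus e).
Proof.
have [e1 e2] := component_edge_terminus e.
apply: sval_inj; apply: etrans (rtranslateI _ _ _) _.
by congr (_ `&` _); apply/esym.
Qed.

Lemma component_product_iso : based_isomorphic GHK GI.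
Proof.
exists meet_vertex, meet_edge; split=> //.
- exact: meet_vertex_bij.
- exact: meet_edge_bij.
- by move=> e; split=> //; apply: meet_vertex_terminus.
- exact: sval_inj.
Qed.

End Isomorphism.

Theorem proposition4p21 (X : finType) (R : set (word X))
    (H K : set (pres_group R))
    (hH : finite_index_subgroup H) (hK : finite_index_subgroup K) :
  finite_index_subgroup (H `&` K) /\
  based_isomorphic
    (component_product (subgroup_graph H) (subgroup_graph K))
    (subgroup_graph (H `&` K)).
Proof.
split; first exact: finite_index_subgroupI.
by apply: component_product_iso; [case: hH | case: hK].
Qed.
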